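(* Let $k\ge 1$, and let $P=(p_{i,j})_{i,j=0,\dots,k}$ and $\widetilde P=(\widetilde p_{i,j})_{i,j=0,\dots,k}$ be two skip-free transition matrices on $E_k=\{0,1,\dots,k\}$. Assume that for every $i=0,\dots,k-1$ there exists a positive integer $m(i)$ such that (i) $i+m(i)\le k$; (ii) $p^{(m(i))}_{i,\cdot}\succeq_{st}\widetilde p^{(m(i))}_{i,\cdot}$. Let $\mathbf X=(X_n)_{n\ge 0}$ be a Markov chain with transition matrix $P$ and initial distribution $\pi$, let $\widetilde{\mathbf X}=(\widetilde X_n)_{n\ge 0}$ be a Markov chain with transition matrix $\widetilde P$ and initial distribution $\widetilde\pi$, and suppose $\pi\succeq_{st}\widetilde\pi$. Then $$T_k\preceq_{st}\widetilde T_k .$$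
   Context: A transition (row-stochastic) matrix $P=(p_{i,j})$ on $E_k=\{0,1,\dots,k\}$ is called skip-free (on the right) if $p_{i,j}=0$ whenever $1\le i+1<j$. For a transition matrix $P$, $p^{(n)}_{i,j}$ denotes the $n$-step transition probability from $i$ to $j$, i.e. the $(i,j)$ entry of $P^n$, and $p^{(n)}_{i,\cdot}=(p^{(n)}_{i,0},\dots,p^{(n)}_{i,k})$ is regarded as a probability distribution on $E_k$; similarly $\widetilde p^{(n)}_{i,\cdot}$ for $\widetilde P$. $T_k=\inf\{n\in\mathbb N: X_n\ge k\}$ and $\widetilde T_k=\inf\{n\in\mathbb N:\widetilde X_n\ge k\}$, where $\mathbb N=\{0,1,2,\dots\}$ and $\inf\emptyset=+\infty$. $\preceq_{st}$ denotes the usual stochastic order: for (possibly $+\infty$-valued) random variables, $X\preceq_{st}Y$ (equivalently $Y\succeq_{st}X$) means $\mathbb P(X>t)\le \mathbb P(Y>t)$ for every $t\in\mathbb R$. For probability distributions $\mu,\nu$ on $E_k$, $\mu\preceq_{st}\nu$ means $\sum_{l=j}^k\mu_l\le\sum_{l=j}^k\nu_l$ for every $j=0,\dots,k$. *)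

(* Defs.v *)
From HB Require Import structures.
From mathcomp Require Import all_boot all_order all_algebra.
From mathcomp Require Import all_classical all_reals all_analysis.

Set Implicit Arguments.
Unset Strict Implicit.
Unset Printing Implicit Defensive.

Import Order.TTheory GRing.Theory Num.Theory.

Local Open Scope classical_set_scope.
Local Open Scope ring_scope.

(* The state space E_k = {0, ..., k} is 'I_k.+1; distributions on it are row
   vectors, and the n-step transition probabilities are the entries of P ^+ n. *)

Definition prob_vector (R : realType) (k : nat) (mu : 'rV[R]_k.+1) : Prop :=
  (forall j, 0 <= mu ord0 j) /\ \sum_j mu ord0 j = 1.

Definition transition_matrix (R : realType) (k : nat) (P : 'M[R]_k.+1) : Prop :=
  forall i, prob_vector (row i P).

Definition skip_free (R : realType) (k : nat) (P : 'M[R]_k.+1) : Prop :=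
  forall i j : 'I_k.+1, (i.+1 < j)%N -> P i j = 0.

Definition st_le_vec (R : realType) (k : nat) (mu nu : 'rV[R]_k.+1) : Prop :=
  forall j : 'I_k.+1,
    \sum_(l < k.+1 | (j <= l)%N) mu ord0 l <=
    \sum_(l < k.+1 | (j <= l)%N) nu ord0 l.

(* The two variables may live on different probability spaces. *)
Definition st_le (R : realType) (d d' : measure_display)
    (T : measurableType d) (T' : measurableType d')
    (Pr : probability T R) (Pr' : probability T' R)
    (X : T -> \bar R) (Y : T' -> \bar R) : Prop :=
  forall t : R,
    (Pr [set w | (t%:E < X w)%E] <= Pr' [set w | (t%:E < Y w)%E])%E.

Definition cond_prob (R : realType) (d : measure_display)
    (T : measurableType d) (Pr : probability T R) (A B : set T) : R :=
  fine (Pr (A `&` B)) / fine (Pr B).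

(* 'I_k.+1 carries no measurable structure in the library; measurability of
   X n for the discrete sigma-algebra is measurability of the events X n = i.
   Only the values x 0, ..., x n of the path x matter in the Markov property. *)
Definition markov_chain (R : realType) (d : measure_display)
    (T : measurableType d) (Pr : probability T R) (k : nat)
    (P : 'M[R]_k.+1) (mu : 'rV[R]_k.+1) (X : nat -> T -> 'I_k.+1) : Prop :=
  [/\ forall n i, measurable [set w | X n w = i],
      forall i, Pr [set w | X 0%N w = i] = (mu ord0 i)%:E
    & forall (n : nat) (x : nat -> 'I_k.+1) (j : 'I_k.+1),
        let past := [set w | forall m, (m <= n)%N -> X m w = x m] in
        Pr past != 0%E ->
        cond_prob Pr [set w | X n.+1 w = j] past = P (x n) j].

(* ereal_inf set0 = +oo, so the value is +oo if level a is never reached. *)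
Definition hitting_time (R : realType) (T : Type) (k : nat)
    (X : nat -> T -> 'I_k.+1) (a : nat) (w : T) : \bar R :=
  ereal_inf [set (n%:R : R)%:E | n in [set n : nat | (a <= X n w)%N]].
Arguments hitting_time R {T k} X a w.

(* Main.v *)
(* Let u n i be the probability, started at i, of reaching level k by time n.
   It is nondecreasing in n, and in i as well, because a skip-free chain going
   from i to k has to pass through every state between.  When i + m <= k and
   m <= n, level k cannot be reached before time m, so that
   u n i = \sum_j (P ^+ m) i j * u (n - m) j, while u n i = 0 when n < m.
   Strong induction on n with m = m(i) then compares u for P and P'. *)

Require Import Defs.
From HB Require Import structures.
From mathcomp Require Import all_boot all_order all_algebra.
From mathcomp Require Import all_classical all_reals all_analysis.

Set Implicit Arguments.
Unset Strict Implicit.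
Unset Printing Implicit Defensive.

Import Order.TTheory GRing.Theory Num.Theory.

Local Open Scope classical_set_scope.
Local Open Scope ring_scope.

(** * Stochastic order tested on monotone functions *)

Lemma st_le_sum (R : realType) (k : nat) (mu nu : 'rV[R]_k.+1)
    (f : 'I_k.+1 -> R) :
  (forall i, 0 <= f i) -> (forall i j : 'I_k.+1, (i <= j)%N -> f i <= f j) ->
  st_le_vec mu nu ->
  \sum_l mu ord0 l * f l <= \sum_l nu ord0 l * f l.
Proof.
move=> f0 fmono munu.
(* Summation by parts. The shift by one index with [F 0 = 0] makes the zeroth increment equal to
   [f 0], so the mean of [f] is a combination of tail sums. Its coefficients are nonnegative by [f0]
   at index 0 and by [fmono] elsewhere. *)
pose F n := if n is n'.+1 then f (inord n') else 0.
have fE (l : 'I_k.+1) :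
    f l = \sum_(j < k.+1 | (j <= l)%N) (F j.+1 - F j).
  rewrite -(big_ord_widen k.+1 (fun j => F j.+1 - F j) (ltn_ord l)).
  by rewrite -(big_mkord xpredT (fun j => F j.+1 - F j)) telescope_sumr//= inord_val subr0.
have sumE (la : 'rV[R]_k.+1) : \sum_l la ord0 l * f l =
    \sum_(j < k.+1) (F j.+1 - F j) * \sum_(l < k.+1 | (j <= l)%N) la ord0 l.
  under eq_bigr => l _ do rewrite fE mulr_sumr big_mkcond.
  rewrite exchange_big; apply: eq_bigr => j _ /=.
  by rewrite mulr_sumr [RHS]big_mkcond; apply: eq_bigr => l _; rewrite mulrC.
rewrite !sumE; apply: ler_sum => j _; apply: ler_wpM2l; last exact: munu.
case: j => -[|j] jk /=; first by rewrite subr0.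
by rewrite subr_ge0; apply: fmono; rewrite !inordK// ltnW.
Qed.

(** * Hitting probabilities of level [k], computed from the matrix alone *)

Section HittingProbability.
Variables (R : realType) (k : nat).
Implicit Types (P : 'M[R]_k.+1) (i j : 'I_k.+1) (n m : nat).

(** First-step analysis with level [k] made absorbing; in ['I_k.+1] the test [k <= i] singles out
    the top state. *)
Fixpoint hit_prob P n i : R :=
  if (k <= i)%N then 1 else
  if n is n'.+1 then \sum_j P i j * hit_prob P n' j else 0.

Lemma hit_prob_top P n i : (k <= i)%N -> hit_prob P n i = 1.
Proof. by case: n => [|n] /= ->. Qed.

Lemma hit_probS P n i : (i < k)%N ->
  hit_prob P n.+1 i = \sum_j P i j * hit_prob P n j.
Proof. by rewrite ltnNge /= => /negbTE ->. Qed.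

Lemma transition_matrix_ge0 P i j : transition_matrix P -> 0 <= P i j.
Proof. by move=> /(_ i)[/(_ j)]; rewrite mxE. Qed.

Lemma expmx_ge0 P m i j : transition_matrix P -> 0 <= (P ^+ m) i j.
Proof.
move=> hP; elim: m i j => [|m IHm] i j; first by rewrite expr0 mxE ler0n.
rewrite exprS -mulmxE mxE sumr_ge0// => l _.
by apply: mulr_ge0; [exact: transition_matrix_ge0|exact: IHm].
Qed.

Lemma transition_matrix_sum P i : transition_matrix P -> \sum_j P i j = 1.
Proof. by move=> /(_ i)[_ <-]; apply: eq_bigr => j _; rewrite mxE. Qed.

Lemma hit_prob_ge0 P n i : transition_matrix P -> 0 <= hit_prob P n i.
Proof.
move=> hP; elim: n i => [|n IHn] i /=; case: ifP => // _.
by apply: sumr_ge0 => j _; rewrite mulr_ge0 ?transition_matrix_ge0.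
Qed.

Lemma hit_prob_leS P n i : transition_matrix P ->
  hit_prob P n i <= hit_prob P n.+1 i.
Proof.
move=> hP; elim: n i => [|n IHn] i.
  case: (leqP k i) => ki; first by rewrite !hit_prob_top.
  by rewrite [hit_prob P 0 i]/= leqNgt ki hit_prob_ge0.
case: (leqP k i) => ki; first by rewrite !hit_prob_top.
rewrite !(hit_probS _ _ ki); apply: ler_sum => j _.
by rewrite ler_wpM2l ?transition_matrix_ge0.
Qed.

(** From [i < j] one step leads at most to [i.+1 <= j]. By induction every state so reached has
    value at most [hit_prob P n j], hence so has their average, and one more unit of time only
    increases that bound. *)
Lemma hit_prob_mono P n i j : transition_matrix P -> skip_free P ->
  (i <= j)%N -> hit_prob P n i <= hit_prob P n j.
Proof.
move=> hP sfP; elim: n i j => [|n IHn] i j ij.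
  by rewrite /=; case: (leqP k i) => [/leq_trans/(_ ij)->|]//; case: ifP.
move: ij; rewrite leq_eqVlt => /predU1P[/val_inj->//|ij].
have ik : (i < k)%N by rewrite (leq_trans ij)// -ltnS.
apply: le_trans (hit_prob_leS _ _ hP).
rewrite (hit_probS _ _ ik) -[leRHS]mul1r -(transition_matrix_sum i hP) mulr_suml.
apply: ler_sum => l _; case: (leqP l i.+1) => [li|il].
  by rewrite ler_wpM2l ?transition_matrix_ge0// IHn// (leq_trans li).
by rewrite sfP// !mul0r.
Qed.

(* Skip-freeness with [i + m <= k] keeps the chain below level [k] before time
   [m], so stopping at level [k] is not felt by [P ^+ m]. *)
Lemma hit_prob_iter P m n i : skip_free P -> (i + m <= k)%N ->
  hit_prob P (m + n) i = \sum_j (P ^+ m) i j * hit_prob P n j.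
Proof.
move=> sfP; elim: m i => [|m IHm] i imk.
  rewrite expr0 add0n (bigD1 i)//= big1 ?addr0 => [|j ji].
    by rewrite mxE eqxx mul1r.
  by rewrite mxE eq_sym (negbTE ji) mul0r.
rewrite addSn hit_probS; last by rewrite (leq_trans _ imk)// addnS ltnS leq_addr.
rewrite exprS -mulmxE.
under [RHS]eq_bigr => j _ do rewrite mxE mulr_suml.
rewrite exchange_big; apply: eq_bigr => l _ /=.
(* The induction hypothesis asks for [l + m <= k], which holds when [l <= i.+1]; the other states
   have weight zero. *)
case: (leqP l i.+1) => [li|il]; last first.
  by rewrite sfP// mul0r big1// => j _; rewrite !mul0r.
rewrite IHm; last by rewrite (leq_trans _ imk)// -addSnnS leq_add2r.
by rewrite mulr_sumr; apply: eq_bigr => j _; rewrite mulrA.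
Qed.

Lemma hit_prob_early P n i : skip_free P -> (i + n < k)%N ->
  hit_prob P n i = 0.
Proof.
move=> sfP; elim: n i => [|n IHn] i ik.
  by rewrite /= leqNgt -[X in (X < _)%N]addn0 ik.
rewrite hit_probS; last by rewrite (leq_ltn_trans _ ik)// leq_addr.
rewrite big1// => l _; case: (leqP l i.+1) => [li|il]; last by rewrite sfP ?mul0r.
by rewrite IHn ?mulr0// (leq_ltn_trans _ ik)// -addSnnS leq_add2r.
Qed.

Lemma hit_prob_le P P' n i :
  transition_matrix P -> transition_matrix P' -> skip_free P -> skip_free P' ->
  (forall i, (i < k)%N -> exists m : nat, [/\ (0 < m)%N, (i + m <= k)%N
     & st_le_vec (row i (P' ^+ m)) (row i (P ^+ m))]) ->
  hit_prob P' n i <= hit_prob P n i.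
Proof.
move=> hP hP' sfP sfP' hm; elim/ltn_ind: n i => n IHn i.
case: (leqP k i) => ki; first by rewrite !hit_prob_top.
have [m [m0 imk Pm]] := hm i ki.
case: (ltnP n m) => [nm|mn].
  rewrite (hit_prob_early sfP') ?hit_prob_ge0//.
  by rewrite (leq_trans _ imk)// ltn_add2l.
rewrite -(subnKC mn) !hit_prob_iter//.
have mx (Q Q' : 'M[R]_k.+1) :
    \sum_j Q i j * hit_prob Q' (n - m) j =
    \sum_j (row i Q) ord0 j * hit_prob Q' (n - m) j.
  by apply: eq_bigr => j _; rewrite mxE.
(* Intermediate quantity: [m] steps of [P'], then the hitting probability of [P]. The induction
   hypothesis bounds the left side by it, and the stochastic order of the [m]-step laws bounds it by
   the right side. *)
apply: (@le_trans _ _ (\sum_j (P' ^+ m) i j * hit_prob P (n - m) j)); last first.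
  rewrite !mx; apply: st_le_sum => //; first by move=> j; exact: hit_prob_ge0.
  by move=> j l; exact: hit_prob_mono.
apply: ler_sum => j _; apply: ler_wpM2l.
  exact: expmx_ge0.
by apply: IHn; rewrite ltn_subrL m0 (leq_trans m0).
Qed.

End HittingProbability.

(** * Survival probabilities of a Markov chain in terms of [hit_prob] *)

Definition path_event (T S : Type) (X : nat -> T -> S) (x : nat -> S) (n : nat)
    : set T :=
  [set w | forall m, (m <= n)%N -> X m w = x m].

(** The window has [N.+1] instants; its free starting time [n] lets an induction on [N] move forward
    along the path. *)
Definition survival (T : Type) (k : nat) (X : nat -> T -> 'I_k.+1) (n N : nat)
    : set T :=
  [set w | forall m, (n <= m <= n + N)%N -> (X m w < k)%N].

Section MarkovSurvival.
Variables (R : realType) (d : measure_display) (T : measurableType d).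
Variables (Pr : probability T R) (k : nat).
Variables (P : 'M[R]_k.+1) (mu : 'rV[R]_k.+1) (X : nat -> T -> 'I_k.+1).
Hypothesis (hP : transition_matrix P) (hmu : prob_vector mu).
Hypothesis (hX : markov_chain Pr P mu X).

Lemma measurable_state n (A : pred 'I_k.+1) : measurable [set w | A (X n w)].
Proof.
have [mX _ _] := hX.
rewrite (_ : mkset _ = \bigcup_(i in [set i | A i]) [set w | X n w = i]).
  by apply: fin_bigcup_measurable => // i _; exact: mX.
by apply/seteqP; split=> w /=; [move=> AX; exists (X n w)|case=> i /= Ai ->].
Qed.

Lemma measurable_path x n : measurable (path_event X x n).
Proof.
have [mX _ _] := hX.
rewrite (_ : path_event X x n =
  \bigcap_(m in [set m | (m <= n)%N]) [set w | X m w = x m]) //.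
by apply: bigcap_measurableType => m _; exact: mX.
Qed.

Lemma measurable_survival n N : measurable (survival X n N).
Proof.
rewrite (_ : survival X n N =
  \bigcap_(m in [set m | (n <= m <= n + N)%N]) [set w | (X m w < k)%N]) //.
apply: bigcap_measurableType => m _.
exact: (measurable_state m (fun i => (i < k)%N)).
Qed.

Lemma total_probability n (A : set T) : measurable A ->
  Pr A = (\sum_i Pr (A `&` [set w | X n w = i]))%E.
Proof.
move=> mA; have [mX _ _] := hX.
transitivity (Pr (\bigcup_(i in [set: 'I_k.+1]) (A `&` [set w | X n w = i]))).
  congr (Pr _); apply/seteqP; split=> [w Aw|w [i _ []]//].
  by exists (X n w).
rewrite measure_fin_bigcup; last by move=> i _; exact: measurableI.
- rewrite (fsbigE (index_enum _)) ?index_enum_uniq//=.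
    by apply: eq_bigl => i; exact: mem_set.
  by move=> i _; rewrite mem_index_enum.
- exact: finite_finset.
by move=> i j _ _ [w [[_ /= <-] [_ /= <-]]].
Qed.

Lemma path_event_rcons x n j :
  let x' m := if (m <= n)%N then x m else j in
  path_event X x n `&` [set w | X n.+1 w = j] = path_event X x' n.+1.
Proof.
move=> x'; apply/seteqP; split=> w /=.
  case=> xw Xj m; rewrite /x'; case: (leqP m n) => [mn _|nm mn]; first exact: xw.
  by rewrite -Xj; congr (X _ w); apply/eqP; rewrite eqn_leq mn.
move=> xw; split; last by have := xw n.+1 (leqnn _); rewrite /x' ltnn.
by move=> m mn; have := xw m (leqW mn); rewrite /x' mn.
Qed.

(** The Markov property multiplied out by the probability of the past. In this form it also covers a
    null past, where both sides vanish. *)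
Lemma path_event_step x n j :
  Pr (path_event X x n `&` [set w | X n.+1 w = j]) =
  (Pr (path_event X x n) * (P (x n) j)%:E)%E.
Proof.
have [mX _ step] := hX; have mp := measurable_path x n.
have mI : measurable (path_event X x n `&` [set w | X n.+1 w = j]).
  exact: measurableI.
have [p0|p0] := eqVneq (Pr (path_event X x n)) 0%E.
  rewrite p0 mul0e; apply/eqP; rewrite -measure_le0 -p0.
  by rewrite le_measure ?inE//; exact: subIsetl.
have := step n x j p0; rewrite /cond_prob -/(path_event X x n) setIC => <-.
have fp := fin_num_measure Pr _ mp; have fI := fin_num_measure Pr _ mI.
by rewrite -[Pr (path_event X x n)]fineK// -EFinM mulrC divfK ?fineK// fine_eq0.
Qed.

(** The conditioning is on a whole path because [markov_chain] speaks of whole pasts. Splitting on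
    the next state extends the path by one step, and the recursion of [hit_prob] matches since rows
    of [P] sum to 1. *)
Lemma path_event_survival x n N :
  Pr (path_event X x n `&` survival X n N) =
  (Pr (path_event X x n) * (1 - hit_prob P N (x n))%:E)%E.
Proof.
elim: N n x => [|N IHN] n x; case: (leqP k (x n)) => kx.
- rewrite hit_prob_top// subrr mule0 (_ : _ `&` _ = set0) ?measure0//.
  rewrite -subset0 => w [xw] /(_ n); rewrite leqnn leq_addr => /(_ isT).
  by rewrite xw// ltnNge kx.
- rewrite /= leqNgt kx subr0 mule1; congr (Pr _); apply/setIidPl => w xw m.
  rewrite addn0 -eqn_leq => /eqP <-; by rewrite xw.
- rewrite hit_prob_top// subrr mule0 (_ : _ `&` _ = set0) ?measure0//.
  rewrite -subset0 => w [xw] /(_ n); rewrite leqnn leq_addr => /(_ isT).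
  by rewrite xw// ltnNge kx.
rewrite (total_probability n.+1); last first.
  by apply: measurableI; [exact: measurable_path|exact: measurable_survival].
(* As [x n < k], the path already settles time [n], so the survival window may start at [n.+1]. *)
under eq_bigr => j _.
  rewrite setIAC (_ : _ `&` _ `&` survival X n N.+1 =
      (path_event X x n `&` [set w | X n.+1 w = j]) `&` survival X n.+1 N); last first.
    apply/seteqP; split=> w [[xw Xj] sw]; split=> // m.
      by case/andP=> nm mN; apply: sw; rewrite (ltnW nm) -addSnnS.
    case/andP; rewrite leq_eqVlt => /predU1P[<- _|nm mN]; first by rewrite xw.
    by apply: sw; rewrite nm addSnnS.
  rewrite path_event_rcons IHN -path_event_rcons path_event_step ltnn -muleA -EFinM.
  over.
have fp := fin_num_measure Pr _ (measurable_path x n).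
rewrite -(fineK fp); under eq_bigr => j _ do rewrite -EFinM.
rewrite sumEFin -mulr_sumr EFinM hit_probS//; congr (_ * _%:E)%E.
under eq_bigr => j _ do rewrite mulrBr mulr1.
by rewrite sumrB (transition_matrix_sum _ hP).
Qed.

Lemma path_event0 x : path_event X x 0 = [set w | X 0%N w = x 0%N].
Proof.
apply/seteqP; split=> w /= => [/(_ 0%N)|Xi m]; first exact.
by rewrite leqn0 => /eqP ->.
Qed.

Lemma measure_survival N :
  Pr (survival X 0 N) = (1 - \sum_i mu ord0 i * hit_prob P N i)%:E.
Proof.
have [_ X0 _] := hX.
rewrite (total_probability 0%N (measurable_survival 0 N)).
under eq_bigr => i _.
  rewrite setIC -(path_event0 (fun=> i)) path_event_survival path_event0 X0 -EFinM.
  rewrite mulrBr mulr1.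
  over.
by rewrite sumEFin sumrB (proj2 hmu).
Qed.

End MarkovSurvival.

(** * From hitting times to survival events *)

Lemma lt_hitting_time (R : realType) (T : Type) (k a : nat)
    (X : nat -> T -> 'I_k.+1) (t : R) (w : T) : 0 <= t ->
  (t%:E < hitting_time R X a w)%E <->
  (forall m, (m <= Num.truncn t)%N -> (X m w < a)%N).
Proof.
move=> t0; split=> [tT m mt|Xa].
  rewrite ltnNge; apply/negP => aX; move: tT; rewrite ltNge => /negP; apply.
  apply: ge_ereal_inf; exists (m%:R)%:E; first by exists m.
  by rewrite lee_fin -truncn_ge_nat.
(* Hitting times are integers or infinite: without a hit up to [Num.truncn t], the infimum is at
   least the next integer, which exceeds [t]. *)
have [_ tlt] := andP (truncn_itv t0).
apply: (@lt_le_trans _ _ ((Num.truncn t).+1%:R)%:E); first by rewrite lte_fin.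
apply: le_ereal_inf_tmp => _ [m /= aX <-].
rewrite lee_fin ler_nat ltnNge; apply/negP => /Xa.
by rewrite ltnNge aX.
Qed.

Theorem theorem1 (R : realType) (k : nat) (hk : (1 <= k)%N)
  (P P' : 'M[R]_k.+1)
  (hP : transition_matrix P) (hP' : transition_matrix P')
  (sfP : skip_free P) (sfP' : skip_free P')
  (hm : forall i : 'I_k.+1, (i < k)%N ->
     exists m : nat, [/\ (0 < m)%N, (i + m <= k)%N
       & st_le_vec (row i (P' ^+ m)) (row i (P ^+ m))])
  (mu mu' : 'rV[R]_k.+1)
  (hmu : prob_vector mu) (hmu' : prob_vector mu')
  (mu_st : st_le_vec mu' mu)
  (d d' : measure_display) (T : measurableType d) (T' : measurableType d')
  (Pr : probability T R) (Pr' : probability T' R)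
  (X : nat -> T -> 'I_k.+1) (X' : nat -> T' -> 'I_k.+1)
  (hX : markov_chain Pr P mu X) (hX' : markov_chain Pr' P' mu' X') :
  st_le Pr Pr' (hitting_time R X k) (hitting_time R X' k).
Proof.
(* For negative [t] both events are the whole space, hitting times being nonnegative; truncation
   would wrongly give a condition at time 0. *)
move=> t; have [t0|t0] := ltP t 0.
  have allE (S : Type) (Y : nat -> S -> 'I_k.+1) :
      [set w | (t%:E < hitting_time R Y k w)%E] = setT.
    apply/seteqP; split=> // w _; apply: (@lt_le_trans _ _ 0%E) => //.
    by apply: le_ereal_inf_tmp => _ [m _ <-]; rewrite lee_fin.
  by rewrite !allE !probability_setT.
have survE (S : Type) (Y : nat -> S -> 'I_k.+1) :
    [set w | (t%:E < hitting_time R Y k w)%E] = survival Y 0 (Num.truncn t).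
  by apply/seteqP; split=> w /lt_hitting_time; exact.
rewrite !survE (measure_survival hP hmu hX) (measure_survival hP' hmu' hX').
rewrite lee_fin lerD2l lerN2.
(* Change the matrix first, keeping the initial law [mu'], and then the initial law, using that
   [hit_prob] is monotone in the state. *)
apply: (@le_trans _ _ (\sum_i mu' ord0 i * hit_prob P (Num.truncn t) i)).
  apply: ler_sum => i _; apply: ler_wpM2l; first exact: (proj1 hmu').
  exact: hit_prob_le.
by apply: st_le_sum => // [i|i j]; [exact: hit_prob_ge0|exact: hit_prob_mono].
Qed.
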